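(* Let $X$ be a complex Hilbert space and let $S, T$ be Hermitian linear relations in $X$ with $D(T)\subset D(S)$ and $S(0)\subset T(0)$. Suppose that $T$ is closed and $S$ is $T$-bounded with $T$-bound less than $1$. Then $T+S$ is closed, and $d_+(T+S)=d_+(T)$ and $d_-(T+S)=d_-(T)$.
   Context: $X$ is a complex Hilbert space with inner product $\langle\cdot,\cdot\rangle$. A linear relation in $X$ is a linear subspace $T$ of $X\times X$; it is closed if it is a closed subset of $X\times X$. Its domain is $D(T)=\{x\in X: (x,f)\in T \text{ for some } f\in X\}$, its range is $R(T)=\{f\in X:(x,f)\in T\text{ for some }x\in X\}$, and for $x\in D(T)$ (in particular $x=0$), $T(x)=\{f\in X:(x,f)\in T\}$. The sum of two linear relations is $T+S=\{(x,f+g):(x,f)\in T,\ (x,g)\in S\}$, and for $\lambda\in\mathbf{C}$, $T-\lambda I=\{(x,f-\lambda x):(x,f)\in T\}$. The adjoint is $T^*=\{(y,g)\in X\times X:\langle g,x\rangle=\langle y,f\rangle \text{ for all } (x,f)\in T\}$. $T$ is Hermitian if $T\subset T^*$. Deficiency indices: for $\lambda\in\mathbf{C}$, $d_\lambda(T):=\dim R(T-\lambda I)^\perp$. For Hermitian $T$, $d_\lambda(T)$ is constant on the open upper half-plane and constant on the open lower half-plane; the positive and negative deficiency indices are $d_{\pm}(T):=d_{\pm i}(T)$. Norm of a relation at a point: let $Q_T: X\to X/\overline{T(0)}$ be the natural quotient map, where $X/\overline{T(0)}$ carries the quotient norm. Then $\tilde T_s=Q_T T$ is a single-valued linear operator with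 domain $D(T)$, and for $x\in D(T)$ one sets $\|T(x)\|:=\|\tilde T_s(x)\|$; equivalently, $\|T(x)\|$ is the distance from $y$ to $\overline{T(0)}$ for any $y\in T(x)$. Relative boundedness: $S$ is $T$-bounded if $D(T)\subset D(S)$ and there is a constant $c\ge 0$ with $\|S(x)\|\le c(\|x\|+\|T(x)\|)$ for all $x\in D(T)$. In that case the $T$-bound of $S$ is the infimum of all $b\ge 0$ for which there exists $a\ge 0$ such that $\|S(x)\|\le a\|x\|+b\|T(x)\|$ for all $x\in D(T)$. *)

(* Defs.v *)
From HB Require Import structures.
From mathcomp Require Import all_boot all_order all_algebra.
From mathcomp Require Import all_classical all_reals all_analysis.
From mathcomp Require Import complex.

Set Implicit Arguments.
Unset Strict Implicit.
Unset Printing Implicit Defensive.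

Import Order.TTheory GRing.Theory Num.Theory.
Import numFieldNormedType.Exports.

Local Open Scope classical_set_scope.
Local Open Scope card_scope.
Local Open Scope ring_scope.
Local Open Scope complex_scope.

Section Subspaces.
Context {C : numFieldType}.

Definition subspace {V : lmodType C} (A : set V) : Prop :=
  A 0 /\ forall (a : C) (u v : V), A u -> A v -> A (a *: u + v).

Definition closed_span {V : normedModType C} (A : set V) : set V :=
  smallest [set M | subspace M /\ closed M] A.

End Subspaces.

Section LinearRelations.
Context {R : realType} {X : completeNormedModType R[i]}.
Implicit Types (S T : set (X * X)) (A M : set X) (x y : X).

Definition linear_relation T : Prop := subspace T.

Definition dom T : set X := [set x | exists f, T (x, f)].
Definition ran T : set X := [set f | exists x, T (x, f)].
Definition value T x : set X := [set f | T (x, f)].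

Definition rel_add T S : set (X * X) :=
  [set p | exists f g, [/\ T (p.1, f), S (p.1, g) & p.2 = f + g]].

Definition rel_shift T (lambda : R[i]) : set (X * X) :=
  [set p | exists2 f, T (p.1, f) & p.2 = f - lambda *: p.1].

(* The norm of X is valued in R[i], where it is a nonnegative real. *)
Definition rnorm x : R := complex.Re `|x|.

(* The norm of the class of y in the quotient of X by the closed subspace M. *)
Definition quot_norm M y : R := inf [set rnorm (y - z) | z in M].

(* ||T(x)||, i.e. the norm of the class modulo the closure of T(0) of an
   arbitrary element of T(x); only meaningful for x in dom T. *)
Definition rel_norm T x : R :=
  quot_norm (closure (value T 0)) (xget 0 (value T x)).

Definition rel_bounded T S : Prop :=
  dom T `<=` dom S /\
  exists2 c : R, 0 <= c &
    forall x, dom T x -> rel_norm S x <= c * (rnorm x + rel_norm T x).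

(* Only meaningful when S is T-bounded: inf of the empty set is 0. *)
Definition rel_bound T S : R :=
  inf [set b : R | 0 <= b /\ exists2 a : R, 0 <= a &
    forall x, dom T x -> rel_norm S x <= a * rnorm x + b * rel_norm T x].

Section InnerProduct.
Variable ip : {dot X for Num.conj}.

Definition adjoint T : set (X * X) :=
  [set q | forall x f, T (x, f) -> ip q.2 x = ip q.1 f].

Definition hermitian_rel T : Prop := T `<=` adjoint T.

Definition ortho_compl A : set X := [set y | forall x, A x -> ip x y = 0].

Definition orthonormal_set A : Prop :=
  forall e f, A e -> A f -> ip e f = (e == f)%:R.

Definition orthonormal_basis M A : Prop :=
  orthonormal_set A /\ closed_span A = M.

(* Equality of the dimensions, as possibly infinite cardinals, of two closed
   subspaces: dim M is the cardinality of an orthonormal basis of M, which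
   always exists and does not depend on the basis. *)
Definition dim_eq M1 M2 : Prop :=
  exists E1 E2 : set X,
    [/\ orthonormal_basis M1 E1, orthonormal_basis M2 E2 & E1 #= E2].

(* The deficiency index d_lambda(T) is the dimension of this space. *)
Definition deficiency_space T (lambda : R[i]) : set X :=
  ortho_compl (ran (rel_shift T lambda)).

Definition eq_deficiency (lambda : R[i]) S T : Prop :=
  dim_eq (deficiency_space S lambda) (deficiency_space T lambda).

Definition eq_pos_deficiency := eq_deficiency 'i%C.
Definition eq_neg_deficiency := eq_deficiency (- 'i%C).

End InnerProduct.

Lemma rel_normE T x y :
  linear_relation T -> T (x, y) ->
  rel_norm T x = quot_norm (closure (value T 0)) y.
Proof.
move=> [T00 TL] Txy; rewrite /rel_norm.
have {Txy}Vx : value T x y by [].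
have Ty0 : value T x (xget 0 (value T x)) by exact: xgetPex (ex_intro _ y Vx).
move: (xget _ _) Ty0 => y0 Ty0.
have shift u v z : T (x, u) -> T (x, v) ->
    closure (value T 0) z -> closure (value T 0) (z + (v - u)).
  move=> Tu Tv cz B /= nB.
  have : nbhs z ((fun t => t + (v - u)) @^-1` B).
    by apply: (@cvgD _ _ _ _ _ id (cst (v - u)) z (v - u)) nB;
      [exact: cvg_id | exact: cvg_cst].
  move=> /cz [t [Tt Bt]]; exists (t + (v - u)); split => //.
  rewrite /value /= in Tt *.
  have T0 : T (0, v - u).
    have := TL (-1) _ _ Tu Tv.
    by rewrite scaleN1r; congr T; rewrite /= -[LHS]/(_, _) /= addNr addrC.
  by have := TL 1 _ _ Tt T0; rewrite scale1r -[_ + _]/(_, _) /= addr0.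
rewrite /quot_norm; congr inf; apply/seteqP; split => r /= [z cz <-].
- exists (z + (y - y0)); first exact: shift.
  by congr rnorm; rewrite opprD opprB addrCA subrKC addrC.
- exists (z + (y0 - y)); first exact: shift.
  by congr rnorm; rewrite opprD opprB addrCA subrKC addrC.
Qed.

End LinearRelations.

(* Main.v *)
Require Import Defs.
From HB Require Import structures.
From mathcomp Require Import all_boot all_order all_algebra.
From mathcomp Require Import all_classical all_reals all_analysis.
From mathcomp Require Import complex ring lra.

(** The closedness of [T + S] and the equality of the deficiency indices both
    rest on one selection: every [x] in the domain of [T] has a [g] in [S x]
    with [|g| <= a |x| + b |f|] for all [f] in [T x], where [b < 1]
    ([selection_bound_exists]). As [S 0 `<=` T 0], every element of
    [(T + S) x] is [f + g] with [f] in [T x] and [g] selected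
    ([rel_add_select]), so multivaluedness causes no trouble.

    Closedness ([rel_add_closed]): [|f|] is at most
    [(|f + g| + a |x|) / (1 - b)], hence the [T]-parts of a rapidly convergent
    sequence in [T + S] converge as well.

    Deficiency indices: write [~] for the existence of a unitary operator of
    [X] carrying one deficiency space onto the other. For a Hermitian [T] and a
    real [s], [|f - i s x|^2 = |f|^2 + s^2 |x|^2] on [T]. Therefore
    [f - i s x] and [f + g - i s x] differ by at most [a / |s| + b] times the
    norm of the first, and this is less than [1] when [|s|] is large
    ([deficiency_perturb]). In the same way [f - i N s x] and [f - i s x]
    differ by at most [(N - 1) / N] times the norm of the first
    ([deficiency_shift]). With [N] large, the theorem follows from the chain
    [T + S] at [i s] [~] [T + S] at [i N s] [~] [T] at [i N s] [~] [T] at [i s],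
    used with [s = 1] and [s = -1].

    Each link is an instance of a fact on subspaces [A] and [B]: if every
    vector of one is within [c < 1] times its norm of the other, and
    conversely, then a unitary operator carries the orthogonal complement of
    [A] onto that of [B] ([ortho_compl_gap]). Indeed the projections [P], [Q]
    onto the closures satisfy [|P - Q| <= c], and [W = Q P + (1 - Q) (1 - P)]
    satisfies [W P = Q W] and [W^* W = W W^* = 1 - (P - Q)^2], so that
    [U = W (1 - (P - Q)^2)^(-1/2)] is unitary with [U P = Q U]
    ([unitary_of_close_proj]). The square root comes from the iteration
    [Y -> (K + Y^2) / 2] with [K = (P - Q)^2] ([sqrt_one_minus]).

    Finally, a unitary operator carries an orthonormal basis of one deficiency
    space bijectively onto an orthonormal basis of the other
    ([dim_eq_unitary]). *)

Import Order.TTheory GRing.Theory Num.Theory.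
Import numFieldNormedType.Exports.

Local Open Scope classical_set_scope.
Local Open Scope ring_scope.
Local Open Scope complex_scope.

(** * The real-valued norm *)

Section RealNorm.
Context {R : realType} {X : completeNormedModType R[i]}.
Implicit Types (x y z : X) (r : R) (A : set X).

Lemma rnormE x : (rnorm x)%:C = `|x|.
Proof. by apply: RRe_real; apply: ger0_real. Qed.

Lemma rnorm_ge0 x : 0 <= rnorm x.
Proof. by rewrite -lecR rnormE; exact: normr_ge0. Qed.

Lemma rnorm0 : rnorm (0 : X) = 0.
Proof. by apply: complexI; rewrite rnormE normr0. Qed.

Lemma rnorm_le0 x : rnorm x <= 0 -> x = 0.
Proof.
move=> x0; apply/normr0_eq0; rewrite -rnormE.
by have /le_anti -> : rnorm x <= 0 <= rnorm x by rewrite x0 rnorm_ge0.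
Qed.

Lemma rnormN x : rnorm (- x) = rnorm x.
Proof. by rewrite /rnorm normrN. Qed.

Lemma rdistC x y : rnorm (x - y) = rnorm (y - x).
Proof. by rewrite -rnormN opprB. Qed.

Lemma ler_rnormD x y : rnorm (x + y) <= rnorm x + rnorm y.
Proof. by rewrite -lecR rmorphD/= !rnormE ler_normD. Qed.

Lemma ler_rnormB x y : rnorm (x - y) <= rnorm x + rnorm y.
Proof. by rewrite -(rnormN y) ler_rnormD. Qed.

Lemma ler_rdistD z x y : rnorm (x - y) <= rnorm (x - z) + rnorm (z - y).
Proof. by rewrite -[x - y](subrKA z) ler_rnormD. Qed.

Lemma rnormZc (a : R[i]) x : rnorm (a *: x) = complex.Re `|a| * rnorm x.
Proof.
apply: complexI.
by rewrite rmorphM/= !rnormE normrZ (RRe_real (ger0_real (normr_ge0 a))).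
Qed.

Lemma rnormZ r x : rnorm (r%:C *: x) = `|r| * rnorm x.
Proof. by rewrite rnormZc normc_def/= expr0n addr0 sqrtr_sqr. Qed.

Lemma nbhs_rnormP x (B : set X) :
  nbhs x B <-> exists2 e : R, 0 < e & forall y, rnorm (x - y) < e -> B y.
Proof.
split=> [/nbhs_ballP[e /= e0 eB]|[e e0 eB]].
  have er : e = (complex.Re e)%:C by rewrite RRe_real// gtr0_real.
  exists (complex.Re e); first by rewrite -ltcR -er.
  by move=> y ye; apply: eB; rewrite -ball_normE/= er -rnormE ltcR.
apply/nbhs_ballP; exists e%:C; first by rewrite /= ltcR.
by move=> y; rewrite -ball_normE/= -rnormE ltcR; exact: eB.
Qed.

Lemma closureP_rnorm A x :
  closure A x <-> forall e : R, 0 < e -> exists2 y, A y & rnorm (x - y) < e.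
Proof.
split=> [cl e e0|cl B /nbhs_rnormP[e e0 eB]].
  have /cl[y [Ay ye]] : nbhs x [set y | rnorm (x - y) < e].
    by apply/nbhs_rnormP; exists e.
  by exists y.
by have [y Ay ye] := cl _ e0; exists y; split => //; apply: eB.
Qed.

Lemma closedP_rnorm A :
  closed A <->
  forall x, (forall e : R, 0 < e -> exists2 y, A y & rnorm (x - y) < e) -> A x.
Proof.
split=> [cA x Ax|cA x /closureP_rnorm]; last exact: cA.
by apply: cA; apply/closureP_rnorm.
Qed.

(** Stated on coordinates, since closedness of a relation refers to the product
    topology and not to a norm on pairs. *)
Lemma closedP_rnorm_prod (T : set (X * X)) :
  closed T <->
  forall x h, (forall e : R, 0 < e -> exists y k,
     [/\ T (y, k), rnorm (x - y) < e & rnorm (h - k) < e]) -> T (x, h).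
Proof.
split=> [cT x h xh|cT [x h] cl].
  apply: cT => B [[B1 B2] /= [/nbhs_rnormP[e1 e10 eB1] /nbhs_rnormP[e2 e20 eB2]] sB].
  have e0 : 0 < Order.min e1 e2 by rewrite lt_min e10.
  have [y [k [Tyk]]] := xh _ e0; rewrite !lt_min => /andP[x1 x2] /andP[h1 h2].
  by exists (y, k); split => //; apply: sB; split; [exact: eB1|exact: eB2].
apply: cT => e e0.
have : nbhs (x, h) ([set y | rnorm (x - y) < e] `*` [set k | rnorm (h - k) < e]).
  by exists ([set y | rnorm (x - y) < e], [set k | rnorm (h - k) < e]) => //;
    split; apply/nbhs_rnormP; exists e.
by move=> /cl[[y k] [Tyk [/= ye ke]]]; exists y, k.
Qed.

(** * Convergence at geometric speed *)

Lemma geo_lt (k C e : R) : 0 <= k -> k < 1 -> 0 < e ->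
  exists N, forall n, (N <= n)%N -> C * k ^+ n < e.
Proof.
move=> k0 k1 e0.
have : (fun n => C * k ^+ n) @ \oo --> C * 0.
  by apply: cvgMr; apply: cvg_expr; rewrite ger0_norm.
rewrite mulr0 => /cvgrPdist_lt/(_ _ e0)[N _ HN]; exists N => n Nn.
by have := HN n Nn; rewrite /= sub0r normrN; apply: le_lt_trans; exact: ler_norm.
Qed.

(** The induction needs the sharper bound with [k ^+ n - k ^+ (n + m)], the tail
    of the geometric series. *)
Lemma geo_dist (u : nat -> X) (k C : R) : 0 <= k -> k < 1 ->
  (forall n, rnorm (u n.+1 - u n) <= C * k ^+ n) ->
  forall n m, rnorm (u (n + m)%N - u n) <= C / (1 - k) * k ^+ n.
Proof.
move=> k0 k1 uk n m.
have C0 : 0 <= C.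
  by have := uk 0%N; rewrite expr0 mulr1; apply: le_trans; exact: rnorm_ge0.
have k1' : 0 < 1 - k by lra.
suff : rnorm (u (n + m)%N - u n) <= C / (1 - k) * (k ^+ n - k ^+ (n + m)).
  move=> /le_trans; apply; apply: ler_wpM2l; first by apply: divr_ge0 => //; lra.
  by rewrite lerBlDr lerDl exprn_ge0.
elim: m => [|m IH]; first by rewrite addn0 !subrr rnorm0 mulr0.
rewrite addnS.
have := ler_rdistD (u (n + m)%N) (u (n + m).+1) (u n).
move=> /le_trans; apply.
have := uk (n + m)%N; set a := rnorm _ => a_le.
rewrite exprS.
have -> : C / (1 - k) * (k ^+ n - k * k ^+ (n + m)) =
  C / (1 - k) * (k ^+ n - k ^+ (n + m)) + C * k ^+ (n + m).
  by field; lra.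
lra.
Qed.

(** All limits of sequences below are taken in this form: the explicit rate lets later identities
    be obtained by comparison at each [n], without filters. *)
Lemma geo_cvg (u : nat -> X) (k C : R) : 0 <= k -> k < 1 ->
  (forall n, rnorm (u n.+1 - u n) <= C * k ^+ n) ->
  exists l, forall n, rnorm (l - u n) <= C / (1 - k) * k ^+ n.
Proof.
move=> k0 k1 uk; have ud := geo_dist _ _ _ k0 k1 uk.
have ucvg : cvg (u @ \oo).
  apply/cauchy_cvgP/cauchy_exP => e /= e0.
  have er : e = (complex.Re e)%:C by rewrite RRe_real// gtr0_real.
  have [N HN] := geo_lt _ (C / (1 - k)) (complex.Re e) k0 k1
    ltac:(by rewrite -ltcR -er).
  exists (u N); exists N => // n /= Nn.
  rewrite -ball_normE/= er -rnormE ltcR rdistC.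
  by rewrite -(subnKC Nn); apply: le_lt_trans (HN N (leqnn _)); exact: ud.
exists (lim (u @ \oo)) => n; apply/ler_addgt0Pr => e e0.
have /nbhs_rnormP/ucvg[N _ HN] : exists2 d : R, 0 < d &
    forall y, rnorm (lim (u @ \oo) - y) < d -> rnorm (lim (u @ \oo) - y) < e.
  by exists e.
have := HN (n + N)%N (leq_addl _ _) => /= lN.
have := ler_rdistD (u (n + N)%N) (lim (u @ \oo)) (u n).
have := ud n N; lra.
Qed.

End RealNorm.

(** * The real part of the inner product *)

Section Hilbert.
Context {R : realType} {X : completeNormedModType R[i]}.
Context (ip : {dot X for Num.conj}) (norm_ip : forall x : X, `|x| ^+ 2 = ip x x).
Implicit Types (x y z : X) (r : R) (A F : set X).

(** A real-valued form is symmetric and lets estimates be carried out in the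
    ordered field [R]; by [ipE] it determines [ip]. *)
Definition rip x y : R := complex.Re (ip x y).

Lemma ipC x y : ip y x = (ip x y)^*%C.
Proof. by rewrite hermC/= expr0 mul1r. Qed.

Lemma ipE x y : ip x y = rip x y +i* rip x ('i *: y).
Proof.
rewrite /rip linearZr_LR /=; case: (ip x y) => a b.
rewrite -[Num.conj _]/('i^*)%C /=; congr (_ +i* _); lra.
Qed.

Lemma ripC x y : rip x y = rip y x.
Proof. by rewrite /rip ipC; case: (ip y x). Qed.

Lemma ripDl x y z : rip (x + y) z = rip x z + rip y z.
Proof. by rewrite /rip linearDl raddfD. Qed.

Lemma ripNl x z : rip (- x) z = - rip x z.
Proof. by rewrite /rip linearNl raddfN. Qed.

Lemma ripBl x y z : rip (x - y) z = rip x z - rip y z.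
Proof. by rewrite ripDl ripNl. Qed.

Lemma ripZl r x z : rip (r%:C *: x) z = r * rip x z.
Proof. by rewrite /rip linearZl_LR/=; case: (ip x z) => a b /=; ring. Qed.

Lemma ripDr x y z : rip z (x + y) = rip z x + rip z y.
Proof. by rewrite ripC ripDl !(ripC z). Qed.

Lemma ripNr x z : rip z (- x) = - rip z x.
Proof. by rewrite ripC ripNl !(ripC z). Qed.

Lemma ripBr x y z : rip z (x - y) = rip z x - rip z y.
Proof. by rewrite ripC ripBl !(ripC z). Qed.

Lemma ripZr r x z : rip z (r%:C *: x) = r * rip z x.
Proof. by rewrite ripC ripZl (ripC z). Qed.

Lemma ripZi x y : rip ('i *: x) y = - rip x ('i *: y).
Proof.
rewrite /rip linearZl_LR linearZr_LR /=; case: (ip x y) => a b.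
by rewrite -[Num.conj _]/('i^*)%C /=; ring.
Qed.

Lemma ripZc (a : R[i]) x y : rip (a *: x) y = rip x (a^*%C *: y).
Proof.
rewrite /rip linearZl_LR linearZr_LR /=; congr complex.Re.
by rewrite -[Num.conj _]/((a^*)^*)%C conjcK.
Qed.

Definition ripE := (ripDl, ripNl, ripZl, ripDr, ripNr, ripZr).

Lemma rip0l x : rip 0 x = 0.
Proof. by rewrite /rip linear0l. Qed.

Lemma rip0r x : rip x 0 = 0.
Proof. by rewrite ripC rip0l. Qed.

Lemma rip_sqr x : rip x x = rnorm x ^+ 2.
Proof. by rewrite /rip -norm_ip -rnormE -rmorphXn. Qed.

Lemma rnorm_sqrD x y : rnorm (x + y) ^+ 2 = rnorm x ^+ 2 + 2 * rip x y + rnorm y ^+ 2.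
Proof. by rewrite -!rip_sqr !ripE (ripC y x); ring. Qed.

Lemma rnorm_sqrB x y : rnorm (x - y) ^+ 2 = rnorm x ^+ 2 - 2 * rip x y + rnorm y ^+ 2.
Proof. by rewrite -!rip_sqr !ripE (ripC y x); ring. Qed.

Lemma rip_eq0 x : (forall z, rip x z = 0) -> x = 0.
Proof.
move=> x0; apply: rnorm_le0; have := rnorm_ge0 x.
by have := x0 x; rewrite rip_sqr; nra.
Qed.

Lemma rip_inj x y : (forall z, rip x z = rip y z) -> x = y.
Proof.
by move=> xy; apply/eqP; rewrite -subr_eq0; apply/eqP/rip_eq0 => z;
  rewrite ripBl xy subrr.
Qed.

(** Linear identities between vectors, tested against an arbitrary vector. *)
Local Ltac vector_ring := apply: rip_inj => ?; rewrite !ripE; ring.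

(** Cauchy-Schwarz, from the nonnegativity of the squared norm of
    [|y| x - |x| y]. *)
Lemma rip_le x y : rip x y <= rnorm x * rnorm y.
Proof.
have x0 := rnorm_ge0 x; have y0 := rnorm_ge0 y.
have := sqr_ge0 (rnorm ((rnorm y)%:C *: x - (rnorm x)%:C *: y)).
rewrite rnorm_sqrB !rnormZ !ripE !ger0_norm// => H.
have [xy0|xy0] := ltP 0 (rnorm x * rnorm y).
  by rewrite -(ler_pM2l xy0); nra.
have : rnorm x * rnorm y = 0 by nra.
move/eqP; rewrite mulf_eq0 => /orP[] /eqP e0; rewrite e0.
  by rewrite (rnorm_le0 x) ?e0// rip0l mul0r.
by rewrite (rnorm_le0 y) ?e0// rip0r mulr0.
Qed.

Lemma rip_abs x y : `|rip x y| <= rnorm x * rnorm y.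
Proof.
by rewrite ler_norml rip_le andbT lerNl -ripNl -(rnormN x) rip_le.
Qed.

(** * Subspaces and orthogonal projections *)

Definition linear_of (f : X -> X) (fL : linear f) : {linear X -> X} :=
  HB.pack f (GRing.isLinear.Build _ _ _ _ f fL).

Lemma subspaceB A x y : Defs.subspace A -> A x -> A y -> A (x - y).
Proof. by case=> _ AL Ax Ay; have := AL (-1) y x Ay Ax; rewrite scaleN1r addrC. Qed.

Lemma subspaceZ A (a : R[i]) x : Defs.subspace A -> A x -> A (a *: x).
Proof. by case=> A0 AL Ax; have := AL a x 0 Ax A0; rewrite addr0. Qed.

Lemma subspaceD A x y : Defs.subspace A -> A x -> A y -> A (x + y).
Proof. by case=> A0 AL Ax Ay; have := AL 1 x y Ax Ay; rewrite scale1r. Qed.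

Lemma subspace_closure A : Defs.subspace A -> Defs.subspace (closure A).
Proof.
move=> sA; split; first by apply: subset_closure; case: sA.
move=> a u v /closureP_rnorm Au /closureP_rnorm Av; apply/closureP_rnorm => e e0.
set c := complex.Re `|a|.
have c0 : 0 <= c by rewrite /c normc_def sqrtr_ge0.
have e1 : 0 < e / 2 / (c + 1) by apply: divr_gt0; lra.
have [u' Au' uu'] := Au _ e1.
have [v' Av' vv'] := Av _ (ltac:(lra) : 0 < e / 2).
exists (a *: u' + v'); first by case: sA => _; apply.
rewrite opprD addrACA -scalerBr.
apply: le_lt_trans (ler_rnormD _ _) _.
rewrite rnormZc -/c.
have : (c + 1) * rnorm (u - u') < e / 2 by rewrite mulrC -ltr_pdivlMr//; lra.
by have := rnorm_ge0 (u - u'); lra.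
Qed.

(** The parallelogram law makes a minimizing sequence with squared distances
    within [4 ^- n] of the infimum a Cauchy sequence. *)
Lemma nearest_point F x : Defs.subspace F -> closed F ->
  exists2 p, F p & forall f, F f -> rnorm (x - p) <= rnorm (x - f).
Proof.
move=> sF /closedP_rnorm cF.
pose D := [set rnorm (x - f) ^+ 2 | f in F].
have D0 : D !=set0 by exists (rnorm (x - 0) ^+ 2); exists 0 => //; case: sF.
have hD : has_inf D by split=> //; exists 0 => _ [f _ <-]; exact: sqr_ge0.
pose d := inf D.
have dle f : F f -> d <= rnorm (x - f) ^+ 2.
  by move=> Ff; apply: ge_inf; [case: hD|exists f].
have /choice[u uP] (n : nat) : exists f, F f /\ rnorm (x - f) ^+ 2 <= d + (2^-1 ^+ n) ^+ 2.
  have e0 : 0 < (2^-1 ^+ n) ^+ 2 :> R by do 2 apply: exprn_gt0; lra.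
  have [_ [f Ff <-] ltf] := inf_adherent e0 hD.
  by exists f; split=> //; exact: ltW.
have ucauchy n : rnorm (u n.+1 - u n) <= 2 * (2^-1) ^+ n.
  have [Fa au] := uP n.+1; have [Fb bu] := uP n.
  move: (u n.+1) (u n) Fa Fb au bu => a b Fa Fb.
  rewrite (exprS _ n); set t := 2^-1 ^+ n => au bu.
  have t0 : 0 <= t by apply: exprn_ge0; lra.
  (* parallelogram law; the midpoint of a and b has squared distance >= d to x *)
  have Fm : F ((2^-1)%:C *: (a + b)) by apply: subspaceZ => //; exact: subspaceD.
  have := dle _ Fm.
  have := rnorm_sqrB (x - b) (x - a).
  have := rnorm_sqrD (x - b) (x - a).
  have -> : x - b - (x - a) = a - b by rewrite opprB addrC addrA subrK.
  have -> : x - b + (x - a) = 2%:C *: (x - (2^-1)%:C *: (a + b)).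
    rewrite scalerBr scalerA -rmorphM/= divff ?pnatr_eq0// scale1r.
    rewrite -[2%:C]/((1 + 1)%:C) rmorphD/= scalerDl scale1r.
    by rewrite addrACA -opprD (addrC b).
  rewrite rnormZ exprMn ger0_norm ?ler0n//.
  have := rnorm_ge0 (a - b); move: (rnorm (a - b)) => q q0 *.
  rewrite -(@ler_pXn2r _ 2) ?nnegrE//; last by apply: mulr_ge0.
  nra.
have [p pP] := geo_cvg u (2^-1) 2 ltac:(lra) ltac:(lra) ucauchy.
have e24 : 2 / (1 - 2^-1) = 4 :> R by field.
rewrite e24 in pP.
(* 5 = 4 + 1: distance from u n to p, plus the defect of u n *)
have small (e : R) : 0 < e -> exists n, 5 * (2^-1) ^+ n < e.
  move=> e0; have [N HN] := geo_lt (2^-1 : R) 5 e ltac:(lra) ltac:(lra) e0.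
  by exists N; apply: HN.
exists p.
  apply: cF => e /small[n ne]; exists (u n); first by case: (uP n).
  have := pP n; have : 0 <= (2^-1 : R) ^+ n by apply: exprn_ge0; lra.
  lra.
move=> f Ff; apply/ler_addgt0Pr => e /small[n ne].
have := pP n; have [_] := uP n; have := dle _ Ff.
have : 0 <= (2^-1 : R) ^+ n by apply: exprn_ge0; lra.
move: ((2^-1 : R) ^+ n) ne => t ne t0 df ud pu.
have := ler_rdistD (u n) x p; rewrite (rdistC (u n)).
have : rnorm (x - u n) <= rnorm (x - f) + t.
  have := rnorm_ge0 (x - f) => ?.
  by rewrite -(@ler_pXn2r _ 2) ?nnegrE ?rnorm_ge0//; [nra|exact: addr_ge0].
lra.
Qed.

(** For a complex subspace [F], orthogonality of real parts is orthogonality. *)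
Definition is_proj F (P : X -> X) :=
  forall x, F (P x) /\ forall f, F f -> rip (x - P x) f = 0.

(** The nearest point is the projection: moving it by [s f] cannot shorten the
    distance, which kills the term linear in [s]. Linearity follows from the
    uniqueness of the decomposition. *)
Lemma proj_exists F : Defs.subspace F -> closed F ->
  exists P : {linear X -> X}, is_proj F P.
Proof.
move=> sF cF.
have /choice[P PP] x : exists p, F p /\ forall f, F f -> rip (x - p) f = 0.
  have [p Fp pmin] := nearest_point F x sF cF; exists p; split=> // f Ff.
  set r := rip (x - p) f.
  have key s : 2 * s * r <= s ^+ 2 * rnorm f ^+ 2.
    have Fq : F (p + s%:C *: f) by apply: subspaceD => //; exact: subspaceZ.
    have := pmin _ Fq; rewrite opprD addrA -(@ler_pXn2r _ 2) ?nnegrE ?rnorm_ge0//.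
    rewrite (rnorm_sqrB (x - p)) rnormZ ripZr exprMn -/r real_normK ?num_real//; lra.
  set N := rnorm f ^+ 2 in key.
  have N0 : 0 <= N by exact: sqr_ge0.
  have N1 : 0 < N + 1 by lra.
  (* r / N is the optimal s; N + 1 avoids the case f = 0 *)
  have := key (r / (N + 1)).
  have -> : 2 * (r / (N + 1)) * r = 2 * (N + 1) * (r / (N + 1)) ^+ 2 by field; lra.
  rewrite expr_div_n => w.
  have r2 : r ^+ 2 / (N + 1) ^+ 2 <= 0.
    have : 0 <= r ^+ 2 / (N + 1) ^+ 2 by apply: divr_ge0; exact: sqr_ge0.
    by nra.
  rewrite ler_pdivrMr ?exprn_gt0// mul0r in r2.
  by apply/eqP; rewrite -sqrf_eq0; apply/eqP/le_anti; rewrite r2 sqr_ge0.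
have Fz x f : F f -> rip (P x) f = rip x f.
  by move=> Ff; have := (PP x).2 f Ff; rewrite ripBl => /eqP; rewrite subr_eq0 => /eqP.
have PL : linear P.
  move=> a x y; apply/eqP; rewrite -subr_eq0; apply/eqP.
  set w := _ - _.
  have Fw : F w.
    apply: subspaceB => //; first exact: (PP _).1.
    by case: sF => _; apply; exact: (PP _).1.
  apply: rnorm_le0; suff : rip w w = 0 by rewrite rip_sqr; have := rnorm_ge0 w; nra.
  rewrite {1}/w ripBl Fz// -ripBl opprD addrACA ripDl (PP y).2// addr0.
  by rewrite -scalerBr ripZc; apply: (PP x).2; exact: subspaceZ.
by exists (linear_of P PL).
Qed.

Section Projection.
Context (F : set X) (P : {linear X -> X}) (PP : is_proj F P).

Lemma proj_mem x : F (P x). Proof. exact: (PP x).1. Qed.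

Lemma proj_ripr x f : F f -> rip (P x) f = rip x f.
Proof. by move=> Ff; have := (PP x).2 f Ff; rewrite ripBl; lra. Qed.

Lemma proj_sa x y : rip (P x) y = rip x (P y).
Proof.
rewrite ripC -(proj_ripr y); last exact: proj_mem.
by rewrite ripC proj_ripr//; exact: proj_mem.
Qed.

Lemma proj_fix f : F f -> P f = f.
Proof.
move=> Ff; apply: rip_inj => z; rewrite proj_sa.
by rewrite ripC proj_ripr// ripC.
Qed.

Lemma proj_idem x : P (P x) = P x.
Proof. by rewrite proj_fix//; exact: proj_mem. Qed.

Lemma rip_proj x : rip (P x) x = rnorm (P x) ^+ 2.
Proof. by rewrite -rip_sqr [RHS]proj_sa proj_idem ripC. Qed.

Lemma proj_pythagoras x : rnorm x ^+ 2 = rnorm (P x) ^+ 2 + rnorm (x - P x) ^+ 2.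
Proof. by rewrite rnorm_sqrB ripC rip_proj; lra. Qed.

Lemma proj_le x : rnorm (P x) <= rnorm x.
Proof.
rewrite -(@ler_pXn2r _ 2) ?nnegrE ?rnorm_ge0// (proj_pythagoras x) lerDl.
exact: sqr_ge0.
Qed.

End Projection.

(** * Square root of a perturbation of the identity *)

Lemma geo_le (a b k C : R) : 0 <= k -> k < 1 ->
  (forall n, a <= b + C * k ^+ n) -> a <= b.
Proof.
move=> k0 k1 ab; apply/ler_addgt0Pr => e e0.
have [N HN] := geo_lt k C e k0 k1 e0.
by have := ab N; have := HN N (leqnn _); lra.
Qed.

Lemma geo_eq x y (k C : R) : 0 <= k -> k < 1 ->
  (forall n, rnorm (x - y) <= C * k ^+ n) -> x = y.
Proof.
move=> k0 k1 xy; apply/eqP; rewrite -subr_eq0; apply/eqP/rnorm_le0.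
by apply: (geo_le _ _ k C k0 k1) => n; rewrite add0r.
Qed.

(** Neumann series: iterate [u -> x + Y u]. *)
Lemma contraction_surj (Y : {linear X -> X}) (k : R) : 0 <= k -> k < 1 ->
  (forall x, rnorm (Y x) <= k * rnorm x) -> forall x, exists y, y - Y y = x.
Proof.
move=> k0 k1 Yk x.
pose u := fix u n := if n is m.+1 then x + Y (u m) else 0.
have uk n : rnorm (u n.+1 - u n) <= rnorm x * k ^+ n.
  elim: n => [|n IH]; first by rewrite /= raddf0 addr0 subr0 expr0 mulr1.
  have -> : u n.+2 - u n.+1 = Y (u n.+1 - u n).
    by rewrite raddfB /= opprD addrACA subrr add0r.
  apply: le_trans (Yk _) _; rewrite exprS mulrCA.
  exact: ler_wpM2l.
have [l lP] := geo_cvg u k _ k0 k1 uk; exists l.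
set C := _ / _ in lP.
apply: (geo_eq _ _ k (C + C) k0 k1) => n.
have -> : l - Y l - x = (l - u n.+1) - Y (l - u n).
  rewrite raddfB /=; vector_ring.
apply: le_trans (ler_rnormB _ _) _; rewrite mulrDl; apply: lerD.
  apply: le_trans (lP _) _; rewrite exprS mulrCA.
  apply: ler_piMl; last exact: ltW.
  by apply: le_trans (lP n); exact: rnorm_ge0.
apply: le_trans (Yk _) _; apply: le_trans (lP n).
by apply: ler_piMl; [exact: rnorm_ge0|exact: ltW].
Qed.

Lemma linB (Z : {linear X -> X}) x y : Z (x - y) = Z x - Z y.
Proof. exact: raddfB. Qed.

Lemma linD (Z : {linear X -> X}) x y : Z (x + y) = Z x + Z y.
Proof. exact: raddfD. Qed.

Lemma linZ (Z : {linear X -> X}) (a : R[i]) x : Z (a *: x) = a *: Z x.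
Proof. exact: linearZ. Qed.

Section SquareRoot.
Context (K : {linear X -> X}) (k : R) (k0 : 0 <= k) (k1 : k < 1).
Context (Kk : forall x, rnorm (K x) <= k * rnorm x).
Context (Ksa : forall x y, rip (K x) y = rip x (K y)).

(** [Y = 1 - sqrt (1 - K)] solves [Y = (K + Y^2) / 2]. Iterating from [0] keeps
    every iterate a polynomial in [K], hence self-adjoint and commuting with
    whatever commutes with [K]. *)
Fixpoint sqrt_seq n : {linear X -> X} :=
  if n is m.+1 then (2^-1)%:C \*: (K \+ (sqrt_seq m \o sqrt_seq m)) else \0.

Local Notation S := sqrt_seq.

Lemma sqrt_seqS n x : S n.+1 x = (2^-1)%:C *: (K x + S n (S n x)).
Proof. by []. Qed.

(** The ball of radius [k] is stable because [(k + k^2) / 2 <= k]. *)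
Lemma sqrt_seq_bound n x : rnorm (S n x) <= k * rnorm x.
Proof.
elim: n x => [|n IH] x; first by rewrite /= rnorm0 mulr_ge0// rnorm_ge0.
rewrite sqrt_seqS rnormZ ger0_norm; last by lra.
have := ler_rnormD (K x) (S n (S n x)).
have := Kk x; have := IH (S n x); have := IH x; have := rnorm_ge0 x.
move: (rnorm (S n x)) => s x0 sx ssx ? ?.
have : k * s <= k * rnorm x.
  by apply: ler_wpM2l => //; apply: le_trans sx _; apply: ler_piMl => //; exact: ltW.
lra.
Qed.

Lemma sqrt_seq_comm (Z : {linear X -> X}) :
  (forall x, Z (K x) = K (Z x)) -> forall n x, Z (S n x) = S n (Z x).
Proof.
move=> ZK; elim=> [|n IH] x; first by rewrite /= raddf0.
by rewrite !sqrt_seqS linearZ linD ZK !IH.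
Qed.

Lemma sqrt_seqC n m x : S n (S m x) = S m (S n x).
Proof.
apply: sqrt_seq_comm => y; apply/esym; apply: (sqrt_seq_comm K) => //.
Qed.

Lemma sqrt_seq_sa n x y : rip (S n x) y = rip x (S n y).
Proof.
elim: n x y => [|n IH] x y; first by rewrite rip0l rip0r.
by rewrite !sqrt_seqS !ripE Ksa !IH.
Qed.

(** By commutativity, [S n.+1 ^ 2 - S n ^ 2] factors as
    [(S n.+1 + S n) (S n.+1 - S n)], and half of the first factor has norm at
    most [k]. *)
Lemma sqrt_seq_diff n x : rnorm (S n.+1 x - S n x) <= rnorm x * k ^+ n.
Proof.
elim: n x => [|n IH] x.
  rewrite /= addr0 subr0 expr0 mulr1 rnormZ ger0_norm; last by lra.
  have : k * rnorm x <= rnorm x by apply: ler_piMl; [exact: rnorm_ge0|exact: ltW].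
  by have := Kk x; have := rnorm_ge0 (K x); lra.
have -> : S n.+2 x - S n.+1 x =
    (2^-1)%:C *: (S n.+1 (S n.+1 x - S n x) + S n (S n.+1 x - S n x)).
  rewrite 2!sqrt_seqS -scalerBr; congr (_ *: _).
  rewrite !linB (sqrt_seqC n.+1 n).
  by vector_ring.
rewrite rnormZ ger0_norm; last by lra.
set d := _ - _ in IH *.
have := ler_rnormD (S n.+1 d) (S n d).
have := sqrt_seq_bound n.+1 d; have := sqrt_seq_bound n d.
rewrite exprS mulrCA.
have : k * rnorm d <= k * (rnorm x * k ^+ n) by apply: ler_wpM2l => //; exact: IH.
lra.
Qed.

(** [D] is the square root of [1 - K]. It is invertible because [1 - D] is a
    contraction, and the commutation clause asks for a bounded [Z] so that it
    passes to the limit. *)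
Lemma sqrt_one_minus : exists D : {linear X -> X},
  [/\ forall x, D (D x) = x - K x,
      forall x y, rip (D x) y = rip x (D y),
      injective D,
      forall x, exists y, D y = x &
      forall (Z : {linear X -> X}) (M : R), 0 <= M ->
        (forall x, rnorm (Z x) <= M * rnorm x) ->
        (forall x, Z (K x) = K (Z x)) -> forall x, Z (D x) = D (Z x)].
Proof.
have /choice[Y YP] x : exists l, forall n, rnorm (l - S n x) <= rnorm x / (1 - k) * k ^+ n.
  exact: (geo_cvg (S^~ x)) (sqrt_seq_diff^~ x).
pose C x := rnorm x / (1 - k).
have C0 x : 0 <= C x by rewrite /C divr_ge0 ?rnorm_ge0// subr_ge0 ltW.
have YL : linear Y.
  move=> a x y.
  apply: (geo_eq _ _ k (C (a *: x + y) + (complex.Re `|a| * C x + C y)) k0 k1) => n.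
  have -> : Y (a *: x + y) - (a *: Y x + Y y) =
      (Y (a *: x + y) - S n (a *: x + y)) - (a *: (Y x - S n x) + (Y y - S n y)).
    rewrite linearP scalerBr; vector_ring.
  apply: le_trans (ler_rnormB _ _) _; rewrite mulrDl; apply: lerD; first exact: YP.
  apply: le_trans (ler_rnormD _ _) _; rewrite mulrDl; apply: lerD; last exact: YP.
  rewrite rnormZc -mulrA; apply: ler_wpM2l; last exact: YP.
  by rewrite normc_def sqrtr_ge0.
have YB x : rnorm (Y x) <= k * rnorm x.
  apply: (geo_le _ _ k (C x) k0 k1) => n.
  have := ler_rnormD (S n x) (Y x - S n x); rewrite addrC subrK.
  by have := sqrt_seq_bound n x; have := YP x n; rewrite -/(C x); lra.
pose YY := linear_of Y YL.
have YE x : YY x = Y x by [].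
have YK x : Y x = (2^-1)%:C *: (K x + Y (Y x)).
  apply: (geo_eq _ _ k (C x + (C (Y x) + C x)) k0 k1) => n.
  have -> : Y x - (2^-1)%:C *: (K x + Y (Y x)) = (Y x - S n.+1 x) -
      (2^-1)%:C *: ((Y (Y x) - S n (Y x)) + S n (Y x - S n x)).
    by rewrite sqrt_seqS linB; vector_ring.
  apply: le_trans (ler_rnormB _ _) _; rewrite mulrDl; apply: lerD.
    apply: le_trans (YP _ _) _; rewrite -/(C x) exprS mulrCA.
    by apply: ler_piMl; [apply: mulr_ge0 => //; exact: exprn_ge0|exact: ltW].
  rewrite rnormZ ger0_norm; last by lra.
  have := ler_rnormD (Y (Y x) - S n (Y x)) (S n (Y x - S n x)).
  have := YP (Y x) n; rewrite -/(C _); have := YP x n; rewrite -/(C _).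
  have := sqrt_seq_bound n (Y x - S n x).
  have := rnorm_ge0 (Y x - S n x); have := rnorm_ge0 (Y (Y x) - S n (Y x)).
  have := rnorm_ge0 (S n (Y x - S n x)).
  have : k * rnorm (Y x - S n x) <= rnorm (Y x - S n x).
    by apply: ler_piMl; [exact: rnorm_ge0|exact: ltW].
  rewrite mulrDl; lra.
have Ysa x y : rip (Y x) y = rip x (Y y).
  apply/eqP; rewrite -subr_eq0 -normr_le0.
  apply: (geo_le _ _ k (C x * rnorm y + rnorm x * C y) k0 k1) => n; rewrite add0r.
  have -> : rip (Y x) y - rip x (Y y) =
      rip (Y x - S n x) y - rip x (Y y - S n y).
    by rewrite ripBl ripBr sqrt_seq_sa; ring.
  apply: le_trans (ler_normB _ _) _; rewrite mulrDl; apply: lerD.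
    apply: le_trans (rip_abs _ _) _; rewrite mulrAC.
    by apply: ler_wpM2r; [exact: rnorm_ge0|exact: YP].
  apply: le_trans (rip_abs _ _) _; rewrite -mulrA.
  by apply: ler_wpM2l; [exact: rnorm_ge0|exact: YP].
have Ycomm (Z : {linear X -> X}) (M : R) : 0 <= M ->
    (forall x, rnorm (Z x) <= M * rnorm x) ->
    (forall x, Z (K x) = K (Z x)) -> forall x, Z (Y x) = Y (Z x).
  move=> M0 ZM ZK x.
  apply: (geo_eq _ _ k (M * C x + C (Z x)) k0 k1) => n.
  have -> : Z (Y x) - Y (Z x) = Z (Y x - S n x) - (Y (Z x) - S n (Z x)).
    rewrite linB (sqrt_seq_comm Z ZK).
    by vector_ring.
  apply: le_trans (ler_rnormB _ _) _; rewrite mulrDl; apply: lerD; last exact: YP.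
  apply: le_trans (ZM _) _; rewrite -mulrA; apply: ler_wpM2l => //; exact: YP.
have DL : linear (fun x => x - Y x).
  move=> a x y; rewrite YL scalerBr.
  by vector_ring.
exists (linear_of _ DL); split.
- move=> x /=; rewrite -!YE linB !YE.
  have := congr1 (fun y => 2%:C *: y) (YK x).
  rewrite scalerA -rmorphM/= divff ?pnatr_eq0// scale1r => e.
  apply: rip_inj => z; have := congr1 (rip^~ z) e.
  by rewrite /= !ripE; lra.
- by move=> x y /=; rewrite !ripE Ysa.
- move=> x y /= xy; apply/eqP; rewrite -subr_eq0; apply/eqP/rnorm_le0.
  have : x - y = YY (x - y).
    rewrite linB !YE; apply: rip_inj => z; rewrite !ripE.
    by have := congr1 (rip^~ z) xy; rewrite /= !ripE; lra.
  have k1' : 0 < 1 - k by rewrite subr_gt0.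
  by have := YB (x - y) => + e; rewrite -YE -e -(pmulr_rle0 _ k1'); lra.
- move=> x; have [y <-] := contraction_surj YY k k0 k1 YB x; by exists y.
- by move=> Z M M0 ZM ZK x /=; rewrite linB (Ycomm Z M).
Qed.

End SquareRoot.

(** * Unitary operators and close projections *)

Definition unitary (U : {linear X -> X}) :=
  (forall x y, rip (U x) (U y) = rip x y) /\ (forall y, exists x, U x = y).

Definition unitarily_equiv A F := exists2 U, unitary U & U @` A = F.

Lemma unitary_inj U : unitary U -> injective U.
Proof.
move=> [Uiso _] x y Uxy; apply: rip_inj => z.
by rewrite -Uiso Uxy Uiso.
Qed.

Lemma unitarily_equiv_sym A F : unitarily_equiv A F -> unitarily_equiv F A.
Proof.
case=> U Uu <-; have Uinj := unitary_inj U Uu; case: Uu => Uiso Usurj.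
have /choice[V VP] := Usurj.
have VU x : V (U x) = x by apply: Uinj; rewrite VP.
have VL : linear V by move=> a x y; apply: Uinj; rewrite linearP !VP.
exists (linear_of V VL); first split=> [x y|y] /=.
- by rewrite -Uiso !VP.
- by exists (U y).
- apply/seteqP; split=> [_ [_ [x Ax <-] <-]|x Ax].
    by rewrite -[linear_of V VL _]/(V (U x)) VU.
  by exists (U x); [exists x|exact: VU].
Qed.

Lemma unitarily_equiv_trans A B F :
  unitarily_equiv A B -> unitarily_equiv B F -> unitarily_equiv A F.
Proof.
move=> [U [Uiso Usurj] <-] [V [Viso Vsurj] <-].
exists (V \o U); last by rewrite image_comp.
split=> [x y /=|z]; first by rewrite Viso Uiso.
by have [y <-] := Vsurj z; have [x <-] := Usurj y; exists x.
Qed.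

(** In this section [W] is [Q P + (1 - Q) (1 - P)] with the products expanded,
    [W'] is its adjoint and [K] is [(P - Q)^2]. *)
Section CloseProjections.
Context (F G : set X) (P Q : {linear X -> X}) (PP : is_proj F P) (QP : is_proj G Q).
Context (c : R) (c0 : 0 <= c) (c1 : c < 1).
Context (PQc : forall x, rnorm (P x - Q x) <= c * rnorm x).

Let K : {linear X -> X} := ((P \- Q) \o (P \- Q)).
Let W : {linear X -> X} := ((((idfun \- P) \- Q) \+ (Q \o P)) \+ (Q \o P)).
Let W' : {linear X -> X} := ((((idfun \- P) \- Q) \+ (P \o Q)) \+ (P \o Q)).

Let Pi x : P (P x) = P x. Proof. exact: proj_idem PP x. Qed.
Let Qi x : Q (Q x) = Q x. Proof. exact: proj_idem QP x. Qed.

Let KE x : K x = P x + Q x - P (Q x) - Q (P x).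
Proof.
rewrite /K /= !linB Pi Qi.
by vector_ring.
Qed.

Let WE x : W x = x - P x - Q x + Q (P x) + Q (P x).
Proof. by []. Qed.

Let WE' x : W' x = x - P x - Q x + P (Q x) + P (Q x).
Proof. by []. Qed.

Let Wadj x y : rip (W x) y = rip x (W' y).
Proof.
by rewrite WE WE' !ripE !(proj_sa _ _ PP, proj_sa _ _ QP).
Qed.

Let WPQ x : W (P x) = Q (P x).
Proof. by rewrite WE !Pi; vector_ring. Qed.

Let QW x : Q (W x) = Q (P x).
Proof.
by rewrite WE !(linB, linD) !Qi; vector_ring.
Qed.

Let WW' x : W' (W x) = x - K x.
Proof.
rewrite WE' QW KE WE !(linB, linD) Pi.
by vector_ring.
Qed.

Let W'W x : W (W' x) = x - K x.
Proof.
rewrite WE KE WE' !(linB, linD) !Qi !Pi.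
by vector_ring.
Qed.

(** [U = W D^(-1)], where [D^2 = 1 - K = W' W = W W']: it is isometric as
    [D^(-1) W' W D^(-1) = 1], and intertwines [P] and [Q] since [W] does and
    [D] commutes with [P]. *)
Lemma unitary_of_close_proj : exists2 U : {linear X -> X},
  unitary U & forall x, U (P x) = Q (U x).
Proof.
have cc0 : 0 <= c * c by exact: mulr_ge0.
have cc1 : c * c < 1 by apply: le_lt_trans c1; apply: ler_piMl => //; exact: ltW.
have Kc x : rnorm (K x) <= c * c * rnorm x.
  apply: le_trans (PQc _) _; rewrite -mulrA; apply: ler_wpM2l => //; exact: PQc.
have Ksa x y : rip (K x) y = rip x (K y).
  by rewrite !KE !ripE !(proj_sa _ _ PP, proj_sa _ _ QP); ring.
have [D [DD Dsa Dinj Dsurj Dcomm]] := sqrt_one_minus K (c * c) cc0 cc1 Kc Ksa.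
have DP x : P (D x) = D (P x).
  apply: (Dcomm P 1) => // y; first by rewrite mul1r; exact: proj_le PP y.
  by rewrite !KE !(linB, linD) !Pi; vector_ring.
have /choice[E EP] := Dsurj.
have EL : linear E.
  by move=> a x y; apply: Dinj; rewrite linearP !EP.
exists (W \o linear_of E EL); last first.
  move=> x; rewrite -[LHS]/(W (E (P x))) -[X in _ = Q X]/(W (E x)).
  have -> : E (P x) = P (E x) by apply: Dinj; rewrite EP -DP EP.
  by rewrite WPQ QW.
split=> [x y|y].
  by rewrite -[LHS]/(rip (W (E x)) (W (E y))) Wadj WW' -DD -Dsa !EP.
have [z1 z1E] := Dsurj y; have [z zE] := Dsurj z1.
(* U (D (W' z)) = W (W' z) = D (D z) = y *)
exists (D (W' z)); rewrite -[LHS]/(W (E (D (W' z)))).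
have -> : E (D (W' z)) = W' z by apply: Dinj; rewrite EP.
by rewrite W'W -DD zE z1E.
Qed.

End CloseProjections.

(** * Unitary equivalence of orthogonal complements *)

Lemma proj_nearest F (P : {linear X -> X}) : is_proj F P -> Defs.subspace F ->
  forall x f, F f -> rnorm (x - P x) <= rnorm (x - f).
Proof.
move=> PP sF x f Ff.
rewrite -(@ler_pXn2r _ 2) ?nnegrE ?rnorm_ge0//.
have -> : x - f = (x - P x) + (P x - f) by rewrite subrKA.
rewrite (rnorm_sqrD (x - P x)) (PP x).2; last by apply: subspaceB => //; exact: proj_mem PP x.
by rewrite mulr0 addr0 lerDl sqr_ge0.
Qed.

Lemma ortho_complP A (P : {linear X -> X}) : is_proj (closure A) P ->
  forall y, ortho_compl ip A y <-> P y = 0.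
Proof.
move=> PP y; split=> [Ay|Py x Ax].
  have rA f : A f -> rip f y = 0 by move=> /Ay Af; rewrite /rip Af.
  have cl : closure A (P y) by exact: proj_mem PP y.
  have sq0 : rnorm (P y) ^+ 2 <= 0 -> P y = 0.
    move=> s; apply: rnorm_le0; have := rnorm_ge0 (P y); nra.
  apply: sq0; rewrite -(rip_proj _ _ PP).
  apply/ler_addgt0Pr => e e0; rewrite add0r.
  have y1 : 0 < rnorm y + 1 by have := rnorm_ge0 y; lra.
  have /closureP_rnorm/(_ (e / (rnorm y + 1)))[|u Au ue] := cl; first exact: divr_gt0.
  have -> : rip (P y) y = rip (P y - u) y by rewrite ripBl (rA u)// subr0.
  apply: le_trans (rip_le _ _) _.
  move: ue; rewrite ltr_pdivlMr// => ue; apply: le_trans (ltW ue).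
  by rewrite mulrDr mulr1 lerDl rnorm_ge0.
have Px : P x = x by apply: (proj_fix _ _ PP); exact: subset_closure.
have Piy : P ('i *: y) = 0 by rewrite linZ Py scaler0.
rewrite ipE -Px !(proj_sa _ _ PP) Py Piy !rip0r; reflexivity.
Qed.

(** One-sided gap, measured element by element on the subspaces themselves: this
    is the form in which ranges of shifted relations are compared. *)
Definition gap_le (c : R) A B :=
  forall u, A u -> exists2 v, B v & rnorm (u - v) <= c * rnorm u.

Lemma proj_gap (c : R) A B (Q : {linear X -> X}) : 0 <= c -> c < 1 ->
  Defs.subspace B -> is_proj (closure B) Q ->
  gap_le c A B -> forall p, closure A p -> rnorm (p - Q p) <= c * rnorm p.
Proof.
move=> c0 c1 sB QP AB p /closureP_rnorm Ap; apply/ler_addgt0Pr => e e0.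
have [u Au pu] := Ap (e / 2) ltac:(lra).
have [v Bv uv] := AB u Au.
have := proj_nearest _ _ QP (subspace_closure _ sB) p v (subset_closure Bv).
have := ler_rdistD u p v; have := ler_rdistD p u 0; rewrite !subr0 (rdistC u p) => up ? ?.
have : c * rnorm u <= c * (rnorm (p - u) + rnorm p) by apply: ler_wpM2l.
rewrite mulrDr.
have : c * rnorm (p - u) <= rnorm (p - u).
  by apply: ler_piMl; [exact: rnorm_ge0|exact: ltW].
lra.
Qed.

(** [P x - Q x] is the sum of [(1 - Q) P x] and [- Q (1 - P) x], which are
    orthogonal. The gap bounds the first by [c |P x|]. The second is bounded by
    [c |(1 - P) x|] since [Q (1 - P)] is the adjoint of [(1 - P) Q]. *)
Lemma close_proj_of_gap (c : R) A B (P Q : {linear X -> X}) : 0 <= c -> c < 1 ->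
  Defs.subspace A -> Defs.subspace B ->
  is_proj (closure A) P -> is_proj (closure B) Q ->
  gap_le c A B -> gap_le c B A -> forall x, rnorm (P x - Q x) <= c * rnorm x.
Proof.
move=> c0 c1 sA sB PP QP AB BA x.
have H1 := proj_gap c A B Q c0 c1 sB QP AB (P x) (proj_mem _ _ PP x).
set w := x - P x.
have H2 : rnorm (Q w) <= c * rnorm w.
  have := proj_gap c B A P c0 c1 sA PP BA (Q w) (proj_mem _ _ QP w).
  have := rip_le (Q w - P (Q w)) w.
  have Pw : P w = 0 by rewrite /w linB (proj_idem _ _ PP) subrr.
  rewrite ripBl (proj_sa _ _ PP) Pw rip0r subr0 (rip_proj _ _ QP).
  have := rnorm_ge0 (Q w); have := rnorm_ge0 w.
  move: (rnorm (Q w - _)) (rnorm (Q w)) (rnorm w) => s q r r0 q0 qs sq.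
  have [q_gt0|] := ltP 0 q; last by have := mulr_ge0 c0 r0; lra.
  rewrite -(ler_pM2l q_gt0); have : s * r <= c * q * r by apply: ler_wpM2r.
  lra.
have e : P x - Q x = (P x - Q (P x)) - Q w by rewrite /w linB; vector_ring.
rewrite -(@ler_pXn2r _ 2) ?nnegrE ?rnorm_ge0//; last by apply: mulr_ge0 => //; exact: rnorm_ge0.
rewrite e rnorm_sqrB (QP (P x)).2; last exact: proj_mem QP w.
rewrite mulr0 subr0 exprMn (proj_pythagoras _ _ PP x) mulrDr -!exprMn.
by apply: lerD; rewrite ler_pXn2r ?nnegrE ?rnorm_ge0// mulr_ge0// rnorm_ge0.
Qed.

Lemma ortho_compl_gap (c : R) A B : 0 <= c -> c < 1 ->
  Defs.subspace A -> Defs.subspace B -> gap_le c A B -> gap_le c B A ->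
  unitarily_equiv (ortho_compl ip A) (ortho_compl ip B).
Proof.
move=> c0 c1 sA sB AB BA.
have [P PP] := proj_exists _ (subspace_closure _ sA) (@closed_closure _ A).
have [Q QP] := proj_exists _ (subspace_closure _ sB) (@closed_closure _ B).
have PQc := close_proj_of_gap c A B P Q c0 c1 sA sB PP QP AB BA.
have [U [Uiso Usurj] UP] := unitary_of_close_proj _ _ P Q PP QP c c0 c1 PQc.
exists U => //; apply/seteqP; split=> [_ [x /(ortho_complP _ _ PP) Px <-]|y].
  by apply/(ortho_complP _ _ QP); rewrite -UP Px raddf0.
move=> /(ortho_complP _ _ QP); have [x <-] := Usurj y; rewrite -UP => UPx.
exists x => //; apply/(ortho_complP _ _ PP); apply: rip_eq0 => z.
by rewrite -Uiso UPx rip0l.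
Qed.

(** The sine of the angle between [x] and [y] is at most [c], and it also
    measures the distance from [y] to the line through [x]. The multiple
    [1 - c ^+ 2] works for all such [y]. *)
Lemma reciprocal_gap (c : R) x y : 0 <= c -> c <= 1 ->
  rnorm (x - y) <= c * rnorm x -> rnorm (y - (1 - c ^+ 2)%:C *: x) <= c * rnorm y.
Proof.
move=> c0 c1.
rewrite -(@ler_pXn2r _ 2) ?nnegrE ?rnorm_ge0//; last by rewrite mulr_ge0// rnorm_ge0.
rewrite rnorm_sqrB exprMn => H.
rewrite -(@ler_pXn2r _ 2) ?nnegrE ?rnorm_ge0//; last by rewrite mulr_ge0// rnorm_ge0.
rewrite rnorm_sqrB rnormZ ripZr !exprMn real_normK ?num_real// (ripC y x).
have d0 : 0 <= 1 - c ^+ 2 by rewrite subr_ge0 expr_le1.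
have : 0 <= (1 - c ^+ 2) * (2 * rip x y - (1 - c ^+ 2) * rnorm x ^+ 2 - rnorm y ^+ 2).
  by apply: mulr_ge0 => //; lra.
by move: (c ^+ 2) (rnorm x ^+ 2) (rnorm y ^+ 2) => ? ? ?; lra.
Qed.

(** With elements of [A] and [B] matched in pairs, an estimate relative to the
    [A]-side alone is enough. *)
Lemma ortho_compl_pairing (c : R) A B : 0 <= c -> c < 1 ->
  Defs.subspace A -> Defs.subspace B ->
  (forall u, A u -> exists2 v, B v & rnorm (u - v) <= c * rnorm u) ->
  (forall v, B v -> exists2 u, A u & rnorm (u - v) <= c * rnorm u) ->
  unitarily_equiv (ortho_compl ip A) (ortho_compl ip B).
Proof.
move=> c0 c1 sA sB AB BA; apply: (ortho_compl_gap c) => // v Bv.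
have [u Au uv] := BA v Bv; exists ((1 - c ^+ 2)%:C *: u); first exact: subspaceZ.
by apply: reciprocal_gap => //; exact: ltW.
Qed.

(** * Orthonormal bases *)

Lemma sub_closed_span A : A `<=` closed_span A.
Proof. exact: sub_gen_smallest. Qed.

Lemma closed_span_min A F : Defs.subspace F -> closed F -> A `<=` F -> closed_span A `<=` F.
Proof. by move=> sF cF; apply: smallest_sub. Qed.

Lemma closed_span_closed A : closed (closed_span A).
Proof. by apply: closed_bigI => F [[]]. Qed.

Lemma closed_span_subspace A : Defs.subspace (closed_span A).
Proof.
split=> [F [[[]]] //|a x y Ax Ay F FA].
by have [[[_ FL] _] _] := FA; apply: FL; [exact: Ax|exact: Ay].
Qed.

Lemma ortho_compl_subspace A : Defs.subspace (ortho_compl ip A).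
Proof.
split=> [x _|a x y xA yA z Az]; first exact: linear0r.
by rewrite linearPr /= xA// yA// mulr0 addr0.
Qed.

Lemma ortho_compl_closed A : Defs.subspace A -> closed (ortho_compl ip A).
Proof.
move=> sA.
have [P PP] := proj_exists _ (subspace_closure _ sA) (@closed_closure _ A).
apply/closedP_rnorm => x xA; apply/(ortho_complP _ _ PP)/rnorm_le0.
apply/ler_addgt0Pr => e /xA[y /(ortho_complP _ _ PP) Py xy]; rewrite add0r.
have -> : P x = P (x - y) by rewrite linB Py subr0.
exact: le_trans (proj_le _ _ PP _) (ltW xy).
Qed.

(** A maximal orthonormal subset of [F] spans [F]: otherwise the normalized
    component of a missing vector orthogonal to the span could be added. *)
Lemma orthonormal_basis_exists F : Defs.subspace F -> closed F ->
  exists E, orthonormal_basis ip F E.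
Proof.
move=> sF cF.
pose ON E := E `<=` F /\ orthonormal_set ip E.
have [|E [[EF EO] Emax]] := @Zorn_bigcup X ON.
  move=> C CON Ctot; split; first by move=> x [E /CON[EF _]]; exact: EF.
  move=> e f [E1 C1 E1e] [E2 C2 E2f].
  have [E12|E21] := Ctot _ _ C1 C2.
    by have [_] := CON _ C2; apply => //; exact: E12.
  by have [_] := CON _ C1; apply => //; exact: E21.
exists E; split=> //; apply/seteqP; split; first exact: closed_span_min.
move=> m Fm; apply: contrapT => mE.
have sE := closed_span_subspace E.
have [P PP] := proj_exists _ sE (@closed_span_closed E).
set q := m - P m.
have EF' : closed_span E `<=` F by exact: closed_span_min.
have Fq : F q by apply: subspaceB => //; apply: EF'; exact: proj_mem PP m.
have q0 : 0 < rnorm q.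
  rewrite lt_def rnorm_ge0 andbT; apply/eqP => q0; apply: mE.
  have /rnorm_le0/subr0_eq -> : rnorm q <= 0 by rewrite q0.
  exact: proj_mem PP m.
set e := ((rnorm q)^-1)%:C *: q.
have ee : ip e e = 1.
  rewrite -norm_ip -rnormE rnormZ ger0_norm ?invr_ge0 ?ltW//.
  by rewrite mulVf ?gt_eqF// expr1n.
have Ee f : E f -> ip f e = 0.
  move=> /sub_closed_span Ef.
  have rqf g : closed_span E g -> rip g q = 0.
    by move=> Eg; rewrite ripC (PP m).2.
  rewrite linearZr_LR /= ipE rqf// -[rip f _]opprK -ripZi rqf ?oppr0 ?mulr0//.
  exact: (subspaceZ _ _ _ sE).
have eE f : E f -> ip e f = 0 by move=> /Ee fe; rewrite ipC fe conjc0.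
have nEe : ~ E e by move=> /eE/eqP; rewrite ee oner_eq0.
apply: (Emax (E `|` [set e])).
  split; first by move=> x; left.
  by move=> /(_ e (or_intror erefl)).
split; first by move=> x [/EF//|->]; exact: subspaceZ.
move=> f g [Ef|->] [Eg|->]; first exact: EO.
- by rewrite Ee//; case: eqP => // fe; case: nEe; rewrite -fe.
- by rewrite eE//; case: eqP => // fe; case: nEe; rewrite fe.
- by rewrite ee eqxx.
Qed.

(** Any orthonormal basis [E] of [M1] gives the basis [U @` E] of [M2], and [U]
    is a bijection between the two. *)
Lemma dim_eq_unitary M1 M2 :
  Defs.subspace M1 -> closed M1 -> Defs.subspace M2 -> closed M2 ->
  unitarily_equiv M1 M2 -> dim_eq ip M1 M2.
Proof.
move=> sM1 cM1 sM2 cM2 [U Uu UM].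
have Uinj := unitary_inj U Uu; case: Uu => Uiso Usurj.
have [E EB] := orthonormal_basis_exists _ sM1 cM1.
have Uip x y : ip (U x) (U y) = ip x y.
  by rewrite !ipE -linZ !Uiso.
have Unorm x : rnorm (U x) = rnorm x.
  by apply/eqP; rewrite -(@eqrXn2 _ 2) ?rnorm_ge0// -!rip_sqr Uiso.
exists E, (U @` E); split=> //; last first.
  by rewrite card_eq_sym; apply: inj_card_eq => x y _ _; exact: Uinj.
case: EB => EO ES; split.
  by move=> _ _ [e Ee <-] [f Ef <-]; rewrite Uip EO// (inj_eq Uinj).
apply/seteqP; split.
  apply: closed_span_min => // _ [e Ee <-]; rewrite -UM; exists e => //.
  by rewrite -ES; exact: sub_closed_span.
rewrite -UM => _ [x + <-]; rewrite -ES => Ex F [[sF cF] UEF].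
apply: (Ex (U @^-1` F)); split; last by move=> e Ee; apply: UEF; exists e.
split; first split=> [|a u v Fu Fv]; rewrite /=.
- by rewrite raddf0; case: sF.
- by rewrite linearP; case: sF => _; apply.
apply/closedP_rnorm => u uF; move/closedP_rnorm: cF; apply=> e /uF[y Fy uy].
by exists (U y) => //; rewrite -linB Unorm.
Qed.

(** * Linear relations *)

Implicit Types (S T : set (X * X)).

Lemma relD T x f y g : linear_relation T -> T (x, f) -> T (y, g) -> T (x + y, f + g).
Proof. by case=> _ TL Tx Ty; have := TL 1 _ _ Tx Ty; rewrite scale1r. Qed.

Lemma relB T x f y g : linear_relation T -> T (x, f) -> T (y, g) -> T (x - y, f - g).
Proof.
case=> _ TL Tx Ty; have := TL (-1) _ _ Ty Tx; rewrite scaleN1r addrC.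
exact.
Qed.

Lemma rel_add_linear S T : linear_relation S -> linear_relation T ->
  linear_relation (rel_add T S).
Proof.
move=> [S0 SL] [T0 TL]; split; first by exists 0, 0; split => //; rewrite /= addr0.
move=> a [x1 h1] [x2 h2] [f1 [g1 [/= Tf1 Sg1 ->]]] [f2 [g2 [/= Tf2 Sg2 ->]]].
exists (a *: f1 + f2), (a *: g1 + g2); split.
- exact: TL a _ _ Tf1 Tf2.
- exact: SL a _ _ Sg1 Sg2.
- by rewrite /= scalerDr addrACA.
Qed.

Lemma rel_add_hermitian S T : hermitian_rel ip S -> hermitian_rel ip T ->
  hermitian_rel ip (rel_add T S).
Proof.
move=> Sh Th [y _] [f [g [/= Tf Sg ->]]] x _ [f' [g' [/= Tf' Sg' ->]]].
have := Th _ Tf _ _ Tf'; have := Sh _ Sg _ _ Sg' => /= eS eT.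
by rewrite linearDl linearDr /= eS eT.
Qed.

Lemma ran_shift_subspace T (l : R[i]) : linear_relation T ->
  Defs.subspace (ran (rel_shift T l)).
Proof.
case=> T0 TL; split; first by exists 0, 0 => //=; rewrite scaler0 subr0.
move=> a _ _ [x1 [f1 /= T1 ->]] [x2 [f2 /= T2 ->]].
exists (a *: x1 + x2), (a *: f1 + f2); first exact: TL a _ _ T1 T2.
rewrite /= scalerBr !scalerDr opprD addrACA.
by rewrite !scalerA (mulrC l).
Qed.

(** [ip f x] is real for a Hermitian [T], so the cross term vanishes. *)
Lemma herm_shift_norm T x f (s : R) : hermitian_rel ip T -> T (x, f) ->
  rnorm (f - (s%:C * 'i) *: x) ^+ 2 = rnorm f ^+ 2 + s ^+ 2 * rnorm x ^+ 2.
Proof.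
move=> Th Tf; have := Th _ Tf _ _ Tf => /=.
rewrite (ipC f x) => e.
have fx0 : rip f ('i *: x) = 0.
  by move: e; rewrite ipE => -[]; lra.
rewrite rnorm_sqrB -scalerA ripZr fx0 rnormZ exprMn real_normK ?num_real//.
have -> : rnorm ('i *: x) ^+ 2 = rnorm x ^+ 2.
  rewrite -!rip_sqr ripZi scalerA.
  have -> : 'i * 'i = -1 :> R[i] by rewrite -expr2 sqr_i.
  by rewrite scaleN1r ripNr opprK.
lra.
Qed.

(** The two shifts differ by [(N - 1) s i x], and [N |s| |x|] is at most the norm
    of the shift by [N s i]. Measured against that larger shift, the relative
    distance [(N - 1) / N] stays below [1] for every [N], so a single step
    reaches arbitrarily far. *)
Lemma deficiency_shift T (s N : R) : linear_relation T -> hermitian_rel ip T ->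
  s != 0 -> 1 <= N ->
  unitarily_equiv (deficiency_space ip T ((N * s)%:C * 'i))
    (deficiency_space ip T (s%:C * 'i)).
Proof.
move=> Tl Th s0 N1.
have bound x f : T (x, f) -> rnorm (f - ((N * s)%:C * 'i) *: x - (f - (s%:C * 'i) *: x)) <=
    (N - 1) / N * rnorm (f - ((N * s)%:C * 'i) *: x).
  move=> Tf.
  have -> : f - ((N * s)%:C * 'i) *: x - (f - (s%:C * 'i) *: x) =
      ((1 - N) * s)%:C *: ('i *: x).
    rewrite opprB addrC subrKA -scalerBl -mulrBl -rmorphB/= scalerA.
    by congr (_%:C * _ *: _); ring.
  have ix : rnorm ('i *: x) = rnorm x.
    by rewrite rnormZc normc_def /= expr0n expr1n add0r sqrtr1 mul1r.
  rewrite rnormZ ix normrM distrC (ger0_norm (_ : 0 <= N - 1)) ?subr_ge0// -!mulrA.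
  apply: ler_wpM2l; first by rewrite subr_ge0.
  rewrite ler_pdivlMl; last by lra.
  rewrite -(@ler_pXn2r _ 2) ?nnegrE ?rnorm_ge0//; last first.
    by rewrite mulr_ge0 ?mulr_ge0 ?rnorm_ge0//; lra.
  rewrite (herm_shift_norm T)// !exprMn real_normK ?num_real// mulrA lerDr.
  exact: sqr_ge0.
apply: (ortho_compl_pairing ((N - 1) / N)).
- by apply: divr_ge0; lra.
- by rewrite ltr_pdivrMr; lra.
- exact: ran_shift_subspace.
- exact: ran_shift_subspace.
- move=> _ [x [f /= Tf ->]]; exists (f - (s%:C * 'i) *: x); first by exists x, f.
  exact: bound.
- move=> _ [x [f /= Tf ->]]; exists (f - ((N * s)%:C * 'i) *: x); first by exists x, f.
  exact: bound.
Qed.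

(** The element [g] does not depend on [f]: this is what allows [f] to be
    adjusted once [g] has been selected. *)
Definition selection_bound S T (a b : R) :=
  forall x, dom T x -> exists2 g, S (x, g) &
    forall f, T (x, f) -> rnorm g <= a * rnorm x + b * rnorm f.

(** The norm of [S x] is an infimum that need not be attained on [S x]. An error
    of [|x|] is allowed, which is why [a] is increased by [1]; the norm of [T x]
    is at most [|f|] for every [f] in [T x]. *)
Lemma selection_bound_exists S T : linear_relation S -> linear_relation T ->
  rel_bounded T S -> rel_bound T S < 1 ->
  exists a b, [/\ 0 <= a, 0 <= b, b < 1 & selection_bound S T a b].
Proof.
move=> Sl Tl [domTS [c c0 cP]]; rewrite /rel_bound; set B := [set b | _].
move=> B1.
have hB : has_inf B.
  split; last by exists 0 => b [].
  by exists c; split => //; exists c => // x Tx; rewrite -mulrDr; exact: cP.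
have [b [b0 [a a0 abP]] b1] := inf_adherent (ltac:(by rewrite subr_gt0) : 0 < 1 - inf B) hB.
exists (a + 1), b; split; [lra|by []|by move: b1; rewrite subrKC|].
move=> x Tx; have [h Sh] := domTS _ Tx.
have [x0|x0] := eqVneq x 0.
  exists 0; first by rewrite x0; case: Sl.
  move=> f _; rewrite rnorm0 addr_ge0// mulr_ge0// ?rnorm_ge0//; lra.
(* half of the error for the infimum, half for the closure of S 0 *)
have nx0 : 0 < rnorm x / 2.
  apply: divr_gt0 => //; rewrite lt_def rnorm_ge0 andbT.
  by apply: contraNneq x0 => nx; rewrite (rnorm_le0 x) ?nx.
have hS : has_inf [set rnorm (h - z) | z in closure (value S 0)].
  split; last by exists 0 => _ [z _ <-]; exact: rnorm_ge0.
  by exists (rnorm (h - 0)), 0 => //; apply: subset_closure; case: Sl.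
have [_ [z cz <-] hz] := inf_adherent nx0 hS.
have /closureP_rnorm/(_ _ nx0)[z' Sz' zz'] := cz.
exists (h - z').
  by have := relB _ _ _ _ _ Sl Sh Sz'; rewrite subr0.
move=> f Tf.
have SN := abP x Tx; rewrite (rel_normE Sl Sh) (rel_normE Tl Tf) in SN.
have TN : quot_norm (closure (value T 0)) f <= rnorm f.
  rewrite -[X in _ <= rnorm X]subr0; apply: ge_inf.
    by exists 0 => _ [w _ <-]; exact: rnorm_ge0.
  by exists 0 => //; apply: subset_closure; case: Tl.
have := ler_rdistD z h z'.
have : b * quot_norm (closure (value T 0)) f <= b * rnorm f by apply: ler_wpM2l.
rewrite -/(quot_norm _ _) in hz.
rewrite mulrDl mul1r; lra.
Qed.

(** Since [S 0 `<=` T 0], the part of an element of [S x] that exceeds the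
    selected one can be moved into [T x]. *)
Lemma rel_add_select S T (a b : R) : linear_relation S -> linear_relation T ->
  value S 0 `<=` value T 0 -> selection_bound S T a b ->
  forall x h, rel_add T S (x, h) -> exists f g,
    [/\ T (x, f), S (x, g), h = f + g & rnorm g <= a * rnorm x + b * rnorm f].
Proof.
move=> Sl Tl S0T0 sel x _ [f [g [/= Tf Sg ->]]].
have [g' Sg' gP] := sel x (ex_intro _ f Tf).
have Tf' : T (x, f + (g - g')).
  have /S0T0 T0 : S (0, g - g').
    by have := relB _ _ _ _ _ Sl Sg Sg'; rewrite subrr.
  by have := relD _ _ _ _ _ Tl Tf T0; rewrite addr0.
exists (f + (g - g')), g'; split=> //; last exact: gP.
by rewrite -addrA subrK.
Qed.

(** On [T], both [|f|] and [|s| |x|] are at most the norm of [f - i s x]; hence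
    the selected [g] has norm at most [a / |s| + b] times it. *)
Lemma deficiency_perturb S T (a b s : R) : linear_relation S -> linear_relation T ->
  hermitian_rel ip T -> value S 0 `<=` value T 0 -> dom T `<=` dom S ->
  0 <= a -> 0 <= b -> 0 < `|s| -> a / `|s| + b < 1 -> selection_bound S T a b ->
  unitarily_equiv (deficiency_space ip T (s%:C * 'i))
    (deficiency_space ip (rel_add T S) (s%:C * 'i)).
Proof.
move=> Sl Tl Th S0T0 domTS a0 b0 s0 ab1 sel.
have c0 : 0 <= a / `|s| + b by rewrite addr_ge0// divr_ge0// ltW.
have bound x f g : T (x, f) -> rnorm g <= a * rnorm x + b * rnorm f ->
    rnorm g <= (a / `|s| + b) * rnorm (f - (s%:C * 'i) *: x).
  move=> Tf; have E := herm_shift_norm T x f s Th Tf.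
  set u := rnorm (f - _) in E *.
  have u0 : 0 <= u by exact: rnorm_ge0.
  have fu : rnorm f <= u.
    rewrite -(@ler_pXn2r _ 2) ?nnegrE ?rnorm_ge0// E lerDl.
    by rewrite mulr_ge0 ?sqr_ge0.
  have xu : rnorm x <= u / `|s|.
    rewrite ler_pdivlMr// -(@ler_pXn2r _ 2) ?nnegrE//; last first.
      by rewrite mulr_ge0 ?rnorm_ge0.
    by rewrite E exprMn real_normK ?num_real// mulrC lerDr sqr_ge0.
  have : a * rnorm x <= a * (u / `|s|) by apply: ler_wpM2l.
  have : b * rnorm f <= b * u by apply: ler_wpM2l.
  have -> : (a / `|s| + b) * u = a * (u / `|s|) + b * u by ring.
  lra.
apply: (ortho_compl_pairing (a / `|s| + b)) => //.
- exact: ran_shift_subspace.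
- exact/ran_shift_subspace/rel_add_linear.
- move=> _ [x [f /= Tf ->]].
  have [g Sg gP] := sel x (ex_intro _ f Tf).
  exists (f + g - (s%:C * 'i) *: x).
    by exists x, (f + g) => //; exists f, g.
  rewrite [X in rnorm X](_ : _ = - g) ?rnormN; first by apply: bound => //; exact: gP.
  by vector_ring.
- move=> _ [x [h /= /(rel_add_select _ _ _ _ Sl Tl S0T0 sel)[f [g [Tf Sg -> gP]]] ->]].
  exists (f - (s%:C * 'i) *: x); first by exists x, f.
  rewrite [X in rnorm X](_ : _ = - g) ?rnormN; first exact: bound.
  by vector_ring.
Qed.

(** Given a limit [(x, h)] of points [(x_n, h_n)] of [T + S] with distances at
    most [2 ^- n], the differences of consecutive points split with controlled
    [T]-parts. These sum to [f_n] in [T x_n] converging to some [l] in [T x].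
    The [S]-parts [h_n - f_n] converge to [h - l], but [S] need not be closed;
    correcting them by selected elements of [S (x_n - x)], which tend to [0],
    puts them in [S x]. So [h - l] is in [S x] up to the closure of [S 0], and
    that closure lies in [T 0]. *)
Lemma rel_add_closed S T (a b : R) : linear_relation S -> linear_relation T ->
  value S 0 `<=` value T 0 -> dom T `<=` dom S -> closed T ->
  0 <= a -> 0 <= b -> b < 1 -> selection_bound S T a b -> closed (rel_add T S).
Proof.
move=> Sl Tl S0T0 domTS /closedP_rnorm_prod cT a0 b0 b1 sel.
have b1' : 0 < 1 - b by rewrite subr_gt0.
have decomp x h : rel_add T S (x, h) -> exists f, [/\ T (x, f), S (x, h - f) &
    rnorm f <= (rnorm h + a * rnorm x) / (1 - b)].
  move=> /(rel_add_select _ _ _ _ Sl Tl S0T0 sel)[f [g [Tf Sg -> gP]]].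
  exists f; rewrite [f + g - f]addrAC subrr add0r; split=> //.
  have := ler_rnormB (f + g) g; rewrite addrK.
  by rewrite ler_pdivlMr// mulrBr; lra.
apply/closedP_rnorm_prod => x h xh.
have h2 n : 0 < (2^-1 : R) ^+ n by apply: exprn_gt0; lra.
have /choice[p pP] n : exists q : X * X, [/\ rel_add T S q,
    rnorm (x - q.1) < 2^-1 ^+ n & rnorm (h - q.2) < 2^-1 ^+ n].
  by have [y [k [*]]] := xh _ (h2 n); exists (y, k).
have addl := rel_add_linear _ _ Sl Tl.
pose C := (2 + 2 * a) / (1 - b).
have /choice[phi phiP] n : exists f, [/\ T ((p n.+1).1 - (p n).1, f),
    S ((p n.+1).1 - (p n).1, (p n.+1).2 - (p n).2 - f) & rnorm f <= C * 2^-1 ^+ n].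
  have [p1 x1 h1] := pP n.+1; have [p0 x0 h0] := pP n.
  rewrite [p n.+1]surjective_pairing in p1; rewrite [p n]surjective_pairing in p0.
  have [f [Tf Sf fle]] := decomp _ _ (relB _ _ _ _ _ addl p1 p0).
  exists f; split=> //; apply: le_trans fle _; rewrite /C mulrAC.
  apply: ler_wpM2r; first by rewrite invr_ge0 ltW.
  have step (u v w : X) : rnorm (w - u) < 2^-1 ^+ n.+1 -> rnorm (w - v) < 2^-1 ^+ n ->
      rnorm (u - v) <= 2 * 2^-1 ^+ n.
    move=> wu wv; have := ler_rdistD w u v; rewrite (rdistC u w).
    by move: wu wv (h2 n); rewrite exprS; move: (2^-1 ^+ n) => t; lra.
  have := step _ _ _ h1 h0; have : a * rnorm ((p n.+1).1 - (p n).1) <= a * (2 * 2^-1 ^+ n).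
    by apply: ler_wpM2l => //; exact: step x1 x0.
  by move: (2^-1 ^+ n) => t; lra.
have [p0 _ _] := pP 0%N; rewrite [p 0%N]surjective_pairing in p0.
have [f0 [Tf0 Sf0 _]] := decomp _ _ p0.
pose f := fix f n := if n is m.+1 then f m + phi m else f0.
have fP n : T ((p n).1, f n) /\ S ((p n).1, (p n).2 - f n).
  elim: n => [//|n [Tn Sn]] /=; have [T1 S1 _] := phiP n; split.
    by have := relD _ _ _ _ _ Tl Tn T1; rewrite addrC subrK.
  have := relD _ _ _ _ _ Sl Sn S1; rewrite (addrC (p n).1) subrK.
  by congr (S (_, _)); vector_ring.
have fcauchy n : rnorm (f n.+1 - f n) <= C * 2^-1 ^+ n.
  by have [_ _] := phiP n; rewrite /= [f n + _]addrC addrK.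
have [l lP] := geo_cvg f (2^-1) C ltac:(lra) ltac:(lra) fcauchy.
set C' := C / _ in lP.
have C0 : 0 <= C'.
  by have := le_trans (rnorm_ge0 _) (lP 0%N); rewrite expr0 mulr1.
have Txl : T (x, l).
  apply: cT => e e0.
  have [n [ne1 ne2]] : exists n, (2^-1 : R) ^+ n < e /\ C' * 2^-1 ^+ n < e.
    have [N1 HN1] := geo_lt (2^-1 : R) 1 e ltac:(lra) ltac:(lra) e0.
    have [N2 HN2] := geo_lt (2^-1 : R) C' e ltac:(lra) ltac:(lra) e0.
    exists (maxn N1 N2); split; last by apply: HN2; exact: leq_maxr.
    by rewrite -[X in X < _]mul1r; apply: HN1; exact: leq_maxl.
  exists (p n).1, (f n); split; first by case: (fP n).
    by have [_ xp _] := pP n; exact: lt_trans xp ne1.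
  exact: le_lt_trans (lP n) ne2.
(* h - l - g0 lies in the closure of S 0 *)
have [g0 Sg0] := domTS x (ex_intro _ l Txl).
have T0 : T (0, h - l - g0).
  apply: cT => e e0.
  pose M := 1 + C' + (a + b * C').
  have [n ne] : exists n, M * 2^-1 ^+ n < e.
    have [N HN] := geo_lt (2^-1 : R) M e ltac:(lra) ltac:(lra) e0.
    by exists N; exact: HN.
  have [Tn Sn] := fP n; have [_ xp hp] := pP n.
  have Tnx := relB _ _ _ _ _ Tl Tn Txl.
  have [g Sg gP] := sel _ (ex_intro _ _ Tnx).
  have Sx := relB _ _ _ _ _ Sl Sn Sg; rewrite opprB addrC subrK in Sx.
  have S0 := relB _ _ _ _ _ Sl Sx Sg0; rewrite subrr in S0.
  exists 0, ((p n).2 - f n - g - g0); split; first exact: S0T0.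
    by rewrite subr0 rnorm0.
  apply: le_lt_trans ne.
  have -> : h - l - g0 - ((p n).2 - f n - g - g0) = (h - (p n).2) - (l - f n) + g.
    by vector_ring.
  have := ler_rnormD (h - (p n).2 - (l - f n)) g.
  have := ler_rnormB (h - (p n).2) (l - f n).
  have := gP _ Tnx; rewrite (rdistC _ x) (rdistC _ l); have := lP n.
  move: hp xp; rewrite /M; move: (2^-1 ^+ n) => t hp xp lf gle.
  have : a * rnorm (x - (p n).1) <= a * t by apply: ler_wpM2l => //; exact: ltW.
  have : b * rnorm (l - f n) <= b * (C' * t) by exact: ler_wpM2l.
  lra.
exists (l + (h - l - g0)), g0; split=> //=.
  by have := relD _ _ _ _ _ Tl Txl T0; rewrite addr0.
by rewrite addrC addrA; vector_ring.
Qed.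

(** The shift [N s] is large enough for [deficiency_perturb], and
    [deficiency_shift] moves back to [s] for [T] and for [T + S]. *)
Lemma deficiency_rel_add S T (s : R) : s != 0 ->
  linear_relation S -> linear_relation T ->
  hermitian_rel ip S -> hermitian_rel ip T ->
  dom T `<=` dom S -> value S 0 `<=` value T 0 ->
  rel_bounded T S -> rel_bound T S < 1 ->
  dim_eq ip (deficiency_space ip (rel_add T S) (s%:C * 'i))
    (deficiency_space ip T (s%:C * 'i)).
Proof.
move=> s0 Sl Tl Sh Th domTS S0T0 TS TS1.
have [a [b [a0 b0 b1 sel]]] := selection_bound_exists _ _ Sl Tl TS TS1.
have addl := rel_add_linear _ _ Sl Tl.
have addh := rel_add_hermitian _ _ Sh Th.
have s1 : 0 < `|s| by rewrite normr_gt0.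
(* makes a / (N |s|) < 1 - b, with N >= 1 *)
pose N := 1 + (a + 1) / ((1 - b) * `|s|).
have N1 : 1 <= N.
  by rewrite lerDl divr_ge0 ?mulr_ge0 ?subr_ge0 ?ltW//; lra.
have Ns : a + 1 <= (1 - b) * `|N * s|.
  rewrite normrM (ger0_norm (_ : 0 <= N)) /N; last by rewrite -/N; lra.
  have -> : (1 - b) * ((1 + (a + 1) / ((1 - b) * `|s|)) * `|s|) =
      (1 - b) * `|s| + (a + 1) by field; lra.
  by rewrite lerDr mulr_ge0 ?subr_ge0 ?ltW.
have Ns0 : 0 < `|N * s| by rewrite normr_gt0 mulf_neq0// gt_eqF//; lra.
have E1 := deficiency_shift T s N Tl Th s0 N1.
have E2 := deficiency_shift (rel_add T S) s N addl addh s0 N1.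
have E3 : unitarily_equiv (deficiency_space ip T ((N * s)%:C * 'i))
    (deficiency_space ip (rel_add T S) ((N * s)%:C * 'i)).
  apply: (deficiency_perturb S T a b) => //.
  by rewrite -ltrBrDr ltr_pdivrMr//; lra.
apply: dim_eq_unitary; do ?exact: ortho_compl_subspace.
- exact/ortho_compl_closed/ran_shift_subspace.
- exact/ortho_compl_closed/ran_shift_subspace.
- apply: unitarily_equiv_trans (unitarily_equiv_trans _ _ _ _ E1).
    exact: unitarily_equiv_sym E2.
  exact: unitarily_equiv_sym E3.
Qed.

End Hilbert.

Theorem lemma3p3 (R : realType) (X : completeNormedModType R[i])
    (ip : {dot X for Num.conj})
    (norm_ip : forall x : X, `|x| ^+ 2 = ip x x)
    (S T : set (X * X))
    (S_lin : linear_relation S) (T_lin : linear_relation T)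
    (S_herm : hermitian_rel ip S) (T_herm : hermitian_rel ip T)
    (domTS : dom T `<=` dom S)
    (S0T0 : value S 0 `<=` value T 0)
    (T_closed : closed T)
    (S_bounded : rel_bounded T S)
    (S_bound_lt1 : rel_bound T S < 1) :
  [/\ closed (rel_add T S),
      eq_pos_deficiency ip (rel_add T S) T
    & eq_neg_deficiency ip (rel_add T S) T].
Proof.
have dim s : s != 0 -> dim_eq ip (deficiency_space ip (rel_add T S) (s%:C * 'i))
    (deficiency_space ip T (s%:C * 'i)).
  by move=> s0; exact: deficiency_rel_add.
have [a [b [a0 b0 b1 sel]]] :=
  selection_bound_exists S T S_lin T_lin S_bounded S_bound_lt1.
split; first exact: (rel_add_closed ip norm_ip S T a b).
- by have := dim 1 (oner_neq0 R); rewrite rmorph1 mul1r.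
- have N1 : -1 != 0 :> R by rewrite oppr_eq0 oner_neq0.
  by have := dim (-1) N1; rewrite rmorphN rmorph1 mulN1r.
Qed.
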